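(* Let $z_i:I\to\mathbb{R}$, $i=1,2,\dots,n-1$, be functions of class $C^\infty$ such that $z_1,z_2,\dots,z_{n-1}$ have the same sign, and let $\mathbf{e}_1^0,\mathbf{e}_2^0,\dots,\mathbf{e}_n^0$ be a pseudo-orthonormal $n$-frame at a point $x_0$ of the Minkowski $n$-space $\mathbb{E}_1^n$. Then, up to a p-similarity with center $x_0$, there exists a unique non-null space curve $\alpha:I\to\mathbb{E}_1^n$ parameterized by a spherical arc length parameter such that $\alpha$ satisfies the following conditions: (i) there exists $\sigma_0\in I$ such that $\alpha(\sigma_0)=x_0$ and the Frenet–Serret $n$-frame of $\alpha$ at $x_0$ is $\mathbf{e}_1^0,\mathbf{e}_2^0,\dots,\mathbf{e}_n^0$; (ii) $\tilde\kappa_i(\sigma)=z_i(\sigma)$ for any $\sigma\in I$ and $i=1,2,\dots,n-1$, where $\tilde\kappa_i$ are the p-shape curvatures of $\alpha$.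
   Context: $I\subset\mathbb{R}$ is an open interval. $\mathbb{E}_1^n$ is $\mathbb{R}^n$ with the Lorentzian inner product $\mathbf{x}\cdot\mathbf{y}=\mathbf{x}^TI^*\mathbf{y}$, $I^*=\mathrm{diag}(-1,1,\dots,1)$, $\|\mathbf{x}\|=\sqrt{|\mathbf{x}\cdot\mathbf{x}|}$. A p-similarity is a map $f(x)=\mu\mathbf{A}x+\mathbf{b}$ with $\mu\ne0$ real, $\mathbf{A}$ pseudo-orthogonal ($\mathbf{A}^TI^*\mathbf{A}=I^*$) with $\det\mathbf{A}=1$, $\mathbf{b}\in\mathbb{R}^n$; it has center $x_0$ if it fixes $x_0$. A non-null curve with arc length $s$ is equipped with a Frenet(–Serret) frame: a pseudo-orthonormal frame $\mathbf{e}_1,\dots,\mathbf{e}_n$ with $\mathbf{e}_1=d\alpha/ds$, $\varepsilon_\ell=\mathbf{e}_\ell\cdot\mathbf{e}_\ell\in\{\pm1\}$, satisfying $$\mathbf{e}_1'=\varepsilon_2\kappa_1\mathbf{e}_2,\quad \mathbf{e}_i'=-\varepsilon_{i-1}\kappa_{i-1}\mathbf{e}_{i-1}+\varepsilon_{i+1}\kappa_i\mathbf{e}_{i+1}\ (2\le i\le n-1),\quad \mathbf{e}_n'=-\varepsilon_{n-1}\kappa_{n-1}\mathbf{e}_{n-1},$$ where $'=d/ds$, $\kappa_i=\mathbf{e}_i'\cdot\mathbf{e}_{i+1}$, $\kappa_j>0$ for $1\le j\le n-2$ and $\kappa_{n-1}\neq0$. A spherical arc length parameter $\sigma$ is an arc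 length parameter of the tangent indicatrix $s\mapsto\mathbf{e}_1(s)$, so $d\sigma=\kappa_1ds$. The p-shape curvatures of $\alpha$ are $\tilde\kappa_1=-\frac1{\kappa_1}\frac{d\kappa_1}{d\sigma}$ and $\tilde\kappa_i=\frac{\kappa_i}{\kappa_1}$ for $i=2,\dots,n-1$.
   Formalization: For n ≥ 4 the functions z_2,…,z_{n-2} are assumed positive, since κ_1,κ_2>0 forces κ̃_2>0 and all-negative z_i admit no curve; σ_0 is fixed in advance, arbitrary in I and common to the curves compared, since otherwise uniqueness fails. *)

(* Defs.v *)
(* The dimension of the ambient Minkowski space is written n.+2, so that it
   ranges over all integers >= 2.  Indices are shifted by one: the frame
   e_1, ..., e_(n+2) is indexed by 'I_n.+2, and the curvatures
   kappa_1, ..., kappa_(n+1) are indexed by 'I_n.+1.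
   A function on the open interval I is a function on R of which only the
   values on I are constrained; since I is open, derivatives at points of I
   depend only on these values. *)
From HB Require Import structures.
From mathcomp Require Import all_boot all_order all_algebra.
From mathcomp Require Import all_classical all_reals all_analysis.

Set Implicit Arguments.
Unset Strict Implicit.
Unset Printing Implicit Defensive.

Import Order.TTheory GRing.Theory Num.Theory.
Import numFieldNormedType.Exports.

Local Open Scope ring_scope.
Local Open Scope classical_set_scope.

Definition open_interval (R : realType) (I : set R) : Prop :=
  open I /\ is_interval I.

Definition smooth (R : realType) (V : normedModType R) (I : set R)
    (f : R -> V) : Prop :=
  forall (k : nat) (t : R), I t -> derivable (derive1n k f) t 1.

Section Minkowski.
Variables (R : realType) (n : nat).

Definition Istar : 'M[R]_n.+2 :=
  diag_mx (\row_(j < n.+2) if j == ord0 then -1 else 1).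

Definition ldot (x y : 'cV[R]_n.+2) : R := (x^T *m Istar *m y) 0 0.

Definition lnorm (x : 'cV[R]_n.+2) : R := Num.sqrt `|ldot x x|.

Definition pseudo_orthogonal (A : 'M[R]_n.+2) : Prop :=
  A^T *m Istar *m A = Istar.

Definition p_similarity (f : 'cV[R]_n.+2 -> 'cV[R]_n.+2) : Prop :=
  exists (mu : R) (A : 'M[R]_n.+2) (b : 'cV[R]_n.+2),
    [/\ mu != 0, pseudo_orthogonal A, \det A = 1 &
        forall x, f x = mu *: (A *m x) + b].

Definition has_center (f : 'cV[R]_n.+2 -> 'cV[R]_n.+2) (x0 : 'cV[R]_n.+2) :=
  f x0 = x0.

Definition pseudo_orthonormal (e : 'I_n.+2 -> 'cV[R]_n.+2) : Prop :=
  (forall l, ldot (e l) (e l) = 1 \/ ldot (e l) (e l) = -1) /\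
  (forall l m, l != m -> ldot (e l) (e m) = 0).

Definition non_null_curve (I : set R) (c : R -> 'cV[R]_n.+2) : Prop :=
  smooth I c /\ forall t, I t -> ldot (derive1 c t) (derive1 c t) != 0.

(* [u] is an arc length parameter of [c], as a function of the given
   parameter of [c]; its direction is not prescribed. *)
Definition arc_length (I : set R) (c : R -> 'cV[R]_n.+2) (u : R -> R) : Prop :=
  smooth I (u : R -> R^o) /\ forall t, I t -> `|derive1 u t| = lnorm (derive1 c t).

(* d f / d s, for [f] and [s] given as functions of a common parameter. *)
Definition deriv_wrt (s : R -> R) (f : R -> 'cV[R]_n.+2) (t : R) :
    'cV[R]_n.+2 :=
  (derive1 s t)^-1 *: derive1 f t.

(* Positions in the frame of the two vectors coupled by the i-th curvature:
   [lo i] has value i and [hi i] has value i + 1. *)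
Definition lo (i : 'I_n.+1) : 'I_n.+2 := widen_ord (leqnSn n.+1) i.
Definition hi (i : 'I_n.+1) : 'I_n.+2 := lift ord0 i.

Section Frenet.
Variables (s : R -> R) (e : 'I_n.+2 -> R -> 'cV[R]_n.+2).

Definition eps (l : 'I_n.+2) (t : R) : R := ldot (e l t) (e l t).

Definition kappa (i : 'I_n.+1) (t : R) : R :=
  ldot (deriv_wrt s (e (lo i)) t) (e (hi i) t).

Definition frenet_equations (t : R) : Prop :=
  [/\ deriv_wrt s (e ord0) t
        = (eps (hi ord0) t * kappa ord0 t) *: e (hi ord0) t,
      (forall i j : 'I_n.+1, j = i.+1 :> nat ->
        deriv_wrt s (e (hi i)) t
          = - (eps (lo i) t * kappa i t) *: e (lo i) t
            + (eps (hi j) t * kappa j t) *: e (hi j) t) &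
      deriv_wrt s (e ord_max) t
        = - (eps (lo ord_max) t * kappa ord_max t) *: e (lo ord_max) t].

Definition frenet_frame (I : set R) (c : R -> 'cV[R]_n.+2) : Prop :=
  (forall l, smooth I (e l)) /\
  (forall t, I t ->
    [/\ pseudo_orthonormal (fun l => e l t),
        e ord0 t = deriv_wrt s c t,
        frenet_equations t,
        (forall i : 'I_n.+1, (i < n)%N -> 0 < kappa i t) &
        kappa ord_max t != 0]).

(* The parameter is an arc length parameter of the tangent indicatrix e_1,
   directed so that d sigma = kappa_1 ds. *)
Definition spherical_arc_length (I : set R) : Prop :=
  arc_length I (e ord0) id /\
  forall t, I t -> kappa ord0 t * derive1 s t = 1.

(* To be used with a spherical arc length parameter: the derivative of
   kappa_1 is taken with respect to the given parameter. *)
Definition shape_curvature (i : 'I_n.+1) (t : R) : R :=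
  if i == ord0 then - (kappa ord0 t)^-1 * derive1 (kappa ord0) t
  else kappa i t / kappa ord0 t.

End Frenet.

(* The initial condition and the shape curvatures refer to one and the same
   Frenet frame of c: its last vector, hence the sign of the last curvature,
   is not determined by c alone. *)
Definition has_frame_and_shape (I : set R) (z : 'I_n.+1 -> R -> R)
    (x0 : 'cV[R]_n.+2) (e0 : 'I_n.+2 -> 'cV[R]_n.+2) (sigma0 : R)
    (c : R -> 'cV[R]_n.+2) : Prop :=
  non_null_curve I c /\
  exists (s : R -> R) (e : 'I_n.+2 -> R -> 'cV[R]_n.+2),
    [/\ arc_length I c s,
        frenet_frame s e I c,
        spherical_arc_length s e I,
        c sigma0 = x0 /\ (forall l, e l sigma0 = e0 l) &
        forall i sigma, I sigma -> shape_curvature s e i sigma = z i sigma].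

Definition same_sign (I : set R) (z : 'I_n.+1 -> R -> R) : Prop :=
  (forall i sigma, I sigma -> 0 < z i sigma) \/
  (forall i sigma, I sigma -> z i sigma < 0).

End Minkowski.

(* Main.v *)
(* Over the parameter sigma, the Frenet equations of a curve with p-shape
   curvatures z are the linear system e' = B D e, where D is the diagonal matrix
   of the signs of the frame and B is skew-symmetric with entries
   1, z_2, ..., z_(n-1) next to the diagonal; only the first shape curvature,
   through s'' = z_1 s', sees the speed s' of the curve.
   For two solutions F1, F2 of the system, written as matrices of rows, F1^T D F2
   is constant because B^T = - B.  Hence a solution stays pseudo-orthonormal, and
   solutions with the same initial frame coincide; the speeds of two curves with
   the same data differ by a constant factor mu, so the curves are related by a
   homothety.  Existence reduces to that of global solutions of linear systems,
   after which the curve is an antiderivative of s' e_1 with s' the exponential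
   of an antiderivative of z_1. *)
Require Import Defs.
From HB Require Import structures.
From mathcomp Require Import all_boot all_order all_algebra.
From mathcomp Require Import all_classical all_reals all_analysis.
From mathcomp Require Import zify ring lra.

Set Implicit Arguments.
Unset Strict Implicit.
Unset Printing Implicit Defensive.

Import Order.TTheory GRing.Theory Num.Theory.
Import numFieldNormedType.Exports.

Local Open Scope ring_scope.
Local Open Scope classical_set_scope.

(** * Calculus on an open interval: monotonicity, mean value bounds and antiderivatives *)

Section OpenInterval.
Variables (R : realType) (I : set R).
Hypothesis hI : open_interval I.
Implicit Types (f g h : R -> R) (x y t : R).

Lemma near_open_interval x : I x -> \forall t \near x, I t.
Proof. by move=> Ix; apply: open_nbhs_nbhs; split=> //; exact: hI.1. Qed.

Lemma open_interval_sub x y : I x -> I y -> `[x, y] `<=` I.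
Proof.
by move=> Ix Iy t /=; rewrite in_itv/= => xty; exact: hI.2 Ix Iy t xty.
Qed.

Lemma open_interval_around x : I x -> exists a b, [/\ I a, I b & a < x < b].
Proof.
move=> Ix; have [e /= e0 sub] := near_open_interval Ix.
have e20 : 0 < e / 2 by rewrite divr_gt0.
exists (x - e / 2), (x + e / 2); split.
- apply: sub; rewrite /ball_/= opprB addrC subrK gtr0_norm//.
  by rewrite ltr_pdivrMr// mulr_natr mulr2n ltrDl.
- apply: sub; rewrite /ball_/= opprD addNKr normrN gtr0_norm//.
  by rewrite ltr_pdivrMr// mulr_natr mulr2n ltrDl.
- by rewrite ltrBlDr !ltrDl e20.
Qed.

Lemma eq_in_is_derive (V : normedModType R) (f g : R -> V) x d :
  I x -> {in I, f =1 g} -> is_derive x 1 f d -> is_derive x 1 g d.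
Proof.
move=> Ix fg; apply: near_eq_is_derive.
by near=> y; apply: fg; rewrite inE; near: y; exact: near_open_interval.
Unshelve. all: by end_near. Qed.

Lemma is_derive_ge0_le f f' x y :
  (forall t, I t -> is_derive t 1 f (f' t)) -> I x -> I y -> x <= y ->
  (forall t, I t -> 0 <= f' t) -> f x <= f y.
Proof.
move=> df Ix Iy xy f'0; have sub := @open_interval_sub x y Ix Iy.
have [||c cxy /eqP] := @MVT_segment R f f' x y xy.
- by move=> t txy; apply/df/sub; exact: subset_itv_oo_cc.
- apply: derivable_within_continuous => t txy.
  by have /df[] := sub _ txy.
- rewrite subr_eq => /eqP->; rewrite lerDr mulr_ge0 ?subr_ge0//.
  exact/f'0/sub.
Qed.

(** Both [h - g] and [h + g] have nonnegative derivative, hence are nondecreasing. *)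
Lemma dist_le_of_is_derive g g' h h' x y :
  (forall t, I t -> is_derive t 1 g (g' t)) ->
  (forall t, I t -> is_derive t 1 h (h' t)) ->
  (forall t, I t -> `|g' t| <= h' t) -> I x -> I y -> x <= y ->
  `|g y - g x| <= h y - h x.
Proof.
move=> dg dh gh Ix Iy xy.
have h1 := @is_derive_ge0_le (h - g) (h' - g') x y _ Ix Iy xy.
have h2 := @is_derive_ge0_le (h + g) (h' + g') x y _ Ix Iy xy.
have {}h1 : (h - g) x <= (h - g) y.
  apply: h1 => t It; first by have := dg t It; have := dh t It; exact: is_deriveB.
  by rewrite !fctE subr_ge0 (le_trans _ (gh t It))// ler_norm.
have {}h2 : (h + g) x <= (h + g) y.
  apply: h2 => t It; first by have := dg t It; have := dh t It; exact: is_deriveD.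
  by rewrite !fctE -lerBlDr sub0r (le_trans _ (gh t It))// -normrN ler_norm.
by rewrite !fctE in h1 h2; rewrite ler_norml; apply/andP; split; lra.
Qed.

Lemma is_derive0_eq f x y :
  (forall t, I t -> is_derive t 1 f 0) -> I x -> I y -> f x = f y.
Proof.
move=> df; wlog xy : x y / x <= y => [H|].
  by case: (leP x y) => [|/ltW] xy Ix Iy; [exact: H|apply/esym; exact: H].
move=> Ix Iy; apply/esym/eqP; rewrite -subr_eq0 -normr_le0.
have := @dist_le_of_is_derive f (cst 0) (cst 0) (cst 0) x y df.
rewrite subr0; apply=> // t It /=; by [rewrite normr0|exact: is_derive_cst].
Qed.

Lemma is_derive_continuous f x d : is_derive x 1 f d -> {for x, continuous f}.
Proof. by move=> [df _]; exact/differentiable_continuous/derivable1_diffP. Qed.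

(* Every antiderivative is the difference of two integrals from a common
   lower bound, so the two halves glue at [c]. *)
Lemma antiderivative (c : R) f : I c -> (forall t, I t -> {for t, continuous f}) ->
  exists F, F c = 0 /\ forall t, I t -> is_derive t 1 F (f t).
Proof.
move=> Ic cf; pose mu : {measure set _ -> \bar R} := @lebesgue_measure R.
have intf a b : I a -> I b -> mu.-integrable `[a, b] (EFin \o f).
  move=> Ia Ib; apply: continuous_compact_integrable.
    exact: segment_compact.
  apply: continuous_in_subspaceT => x; rewrite inE => xab.
  exact/cf/(open_interval_sub Ia Ib).
(* One of the two intervals is always empty, so this is the oriented integral from [c] to [x]. *)
pose F x := \int[mu]_(t in `]c, x]) f t - \int[mu]_(t in `]x, c]) f t.
have FB a b x : I a -> I b -> a < c < b -> a < x < b ->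
    F x = \int[mu]_(t in `[a, x]) f t - \int[mu]_(t in `[a, c]) f t.
  move=> Ia Ib /andP[ac cb] /andP[ax xb]; rewrite /F.
  have sub := open_interval_sub Ia Ib.
  have Ix : I x by apply: sub; rewrite /= in_itv/= !ltW.
  have [xc|cx] := leP x c.
    have -> : `]c, x] = set0 by apply: set_itv_ge; rewrite bnd_simp -leNgt.
    rewrite Rintegral_set0 sub0r -[RHS]opprB; congr (- _).
    by rewrite -(@Rintegral_itvB _ _ (BLeft a) (BRight c) x) ?bnd_simp ?(ltW ax)//; exact: intf.
  have -> : `]x, c] = set0 by apply: set_itv_ge; rewrite bnd_simp -leNgt ltW.
  rewrite Rintegral_set0 subr0.
  by rewrite -(@Rintegral_itvB _ _ (BLeft a) (BRight x) c) ?bnd_simp ?ltW//; exact: intf.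
exists F; split.
  by rewrite /F set_itvoc0 Rintegral_set0 subrr.
move=> t It.
have [a1 [b1 [Ia1 Ib1 /andP[a1t tb1]]]] := open_interval_around It.
have [a2 [b2 [Ia2 Ib2 /andP[a2c cb2]]]] := open_interval_around Ic.
(* Both [c] and [t] lie strictly between [a] and [b], so near [t] the function [F] is an integral
   from the fixed point [a] minus a constant. *)
pose a := Num.min a1 a2; pose b := Num.max b1 b2.
have Ia : I a by rewrite /a; case: leP.
have Ib : I b by rewrite /b; case: leP.
have acb : a < c < b by rewrite gt_min lt_max a2c cb2 !orbT.
have atb : a < t < b by rewrite gt_min lt_max a1t tb1.
have /andP[ax xb] := atb.
have [dG G'] := @continuous_FTC1_closed R f a t b xb (intf _ _ Ia Ib) ax (cf _ It).
apply: (@near_eq_is_derive _ _ _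
  ((fun x => \int[mu]_(t in `[a, x]) f t) - cst (\int[mu]_(t in `[a, c]) f t))).
  near=> x; rewrite (FB _ _ _ Ia Ib acb)//.
  by apply/andP; split; near: x; [exact: lt_nbhsr|exact: lt_nbhsl].
rewrite -[f t]subr0; apply: is_deriveB.
by rewrite -G' derive1E; exact: DeriveDef.
Unshelve. all: by end_near. Qed.

End OpenInterval.

(** * Differentiation rules for real functions written pointwise *)

Section Derivatives.
Context {R : realType}.
Implicit Types (f g : R -> R) (x : R).

Lemma is_deriveD_fun f g x df dg : is_derive x 1 f df -> is_derive x 1 g dg ->
  is_derive x 1 (fun t => f t + g t) (df + dg).
Proof. exact: is_deriveD. Qed.

Lemma is_deriveB_fun f g x df dg : is_derive x 1 f df -> is_derive x 1 g dg ->
  is_derive x 1 (fun t => f t - g t) (df - dg).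
Proof. exact: is_deriveB. Qed.

Lemma is_deriveM_fun f g x df dg : is_derive x 1 f df -> is_derive x 1 g dg ->
  is_derive x 1 (fun t => f t * g t) (df * g x + f x * dg).
Proof.
move=> hf hg; apply: (is_derive_eq (is_deriveM hf hg)).
by rewrite addrC [g x *: df]mulrC.
Qed.

Lemma is_deriveZ_fun f x df k : is_derive x 1 f df ->
  is_derive x 1 (fun t => k * f t) (k * df).
Proof. exact: is_deriveZ. Qed.

Lemma is_derive_sum_fun (T : finType) (F : T -> R -> R) (dF : T -> R) x :
  (forall i, is_derive x 1 (F i) (dF i)) ->
  is_derive x 1 (fun t => \sum_i F i t) (\sum_i dF i).
Proof.
move=> hF; rewrite (_ : (fun t => _) = \sum_i F i); last first.
  by apply/funext => t; rewrite fct_sumE.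
elim/big_ind2 : _ => // [|df f dg g]; first exact: is_derive_cst.
exact: is_deriveD.
Qed.

Lemma is_deriveV_fun f x df : f x != 0 -> is_derive x 1 f df ->
  is_derive x 1 (fun t => (f t)^-1) (- (f x) ^- 2 * df).
Proof.
move=> fx hf; have [df1 _] := hf; split; first exact: derivableV.
by rewrite deriveV// (derive_val (is_derive := hf)).
Qed.

Lemma is_derive_expR_fun f x df : is_derive x 1 f df ->
  is_derive x 1 (fun t => expR (f t)) (df * expR (f x)).
Proof. by move=> hf; rewrite mulrC; exact: (@is_derive1_comp _ expR f). Qed.

End Derivatives.

(** * Sequences with geometrically decreasing steps *)

Section GeometricBounds.
Variable R : realType.

Lemma exists_half_pow_lt (b e : R) : 0 < e -> exists k, b / 2 ^+ k < e.
Proof.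
move=> e0; exists (Num.bound (b / e)).
by rewrite ltr_pdivrMr ?exprn_gt0// mulrC -ltr_pdivrMr// upper_nthrootP.
Qed.

Lemma half_pow_le0 (a b : R) : (forall k, a <= b / 2 ^+ k) -> a <= 0.
Proof.
move=> ab; rewrite leNgt; apply/negP => /(exists_half_pow_lt b)[k].
by rewrite ltNge ab.
Qed.

(** The intervals of radius [b / 2 ^+ k] about [u k] are nested; the supremum of their left ends
    lies in all of them, which gives the limit together with its rate. *)
Lemma exists_limit_of_geometric (u : nat -> R) (b : R) :
  (forall k, `|u k.+1 - u k| <= b / 2 ^+ k.+1) ->
  exists l, forall k, `|u k - l| <= b / 2 ^+ k.
Proof.
move=> ub; have b2 k : b / 2 ^+ k = b / 2 ^+ k.+1 + b / 2 ^+ k.+1.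
  by rewrite exprS invfM; field; rewrite expf_neq0.
pose L k := u k - b / 2 ^+ k; pose U k := u k + b / 2 ^+ k.
have L1 k : L k <= L k.+1.
  by have := ub k; rewrite ler_norml => /andP[h _]; rewrite /L (b2 k); lra.
have U1 k : U k.+1 <= U k.
  by have := ub k; rewrite ler_norml => /andP[_ h]; rewrite /U (b2 k); lra.
have Lm : {homo L : i j / (i <= j)%N >-> i <= j}.
  by apply: homo_leq => //; exact: le_trans.
have Um : {homo U : i j / (i <= j)%N >-> j <= i}.
  by apply: homo_leq => // y x z; exact: ge_trans.
have LU i j : L i <= U j.
  rewrite (le_trans (Lm _ _ (leq_maxl i j)))//.
  apply: le_trans (Um _ _ (leq_maxr i j)); rewrite /L /U.
  have := le_trans (normr_ge0 _) (ub (maxn i j)); have := b2 (maxn i j); lra.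
exists (sup (range L)) => k.
have h1 : L k <= sup (range L).
  apply: ub_le_sup; last by exists k.
  by exists (U 0) => _ [i _ <-].
have h2 : sup (range L) <= U k.
  by apply: ge_sup => [|_ [i _ <-]//]; exists (L 0), 0.
by rewrite /L /U in h1 h2; rewrite ler_norml; apply/andP; split; lra.
Qed.

End GeometricBounds.

(** * Global solutions of linear differential systems *)

Section LinearODE.
Variables (R : realType) (I : set R) (c : R) (T : finType).
Variables (A : T -> T -> R -> R) (x0 : T -> R).
Hypotheses (hI : open_interval I) (Ic : I c).
Hypothesis cA : forall i j t, I t -> {for t, continuous (A i j)}.

(** The sum over all entries bounds every row sum, and inherits continuity on [I] from the
    entries. *)
Let m (t : R) : R := 1 + \sum_i \sum_j `|A i j t|.

Lemma continuous_sum_fun (S : finType) (F : S -> R -> R) t :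
  (forall i, {for t, continuous (F i)}) ->
  {for t, continuous (fun x => \sum_i F i x)}.
Proof. by move=> cF; apply: (cvg_big (@add_continuous R^o)) => i _; exact: cF. Qed.

Lemma continuous_mulA (X : T -> R -> R) i t : I t ->
  (forall j, {for t, continuous (X j)}) ->
  {for t, continuous (fun x => \sum_j A i j x * X j x)}.
Proof.
by move=> It cX; apply: continuous_sum_fun => j; apply: cvgM; [exact: cA|exact: cX].
Qed.

Let continuous_m t : I t -> {for t, continuous m}.
Proof.
move=> It; apply: cvgD; first exact: cvg_cst.
by do 2!apply: continuous_sum_fun => ?; apply: cvg_norm; exact: cA.
Qed.

Let norm_mulA_le (X : T -> R) (b : R) i t : (forall j, `|X j| <= b) ->
  `|\sum_j A i j t * X j| <= m t * b.
Proof.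
move=> Xb; rewrite (le_trans (ler_norm_sum _ _ _))//.
have b0 : 0 <= b by exact: le_trans (normr_ge0 _) (Xb i).
rewrite (@le_trans _ _ ((\sum_j `|A i j t|) * b))//.
  rewrite mulr_suml ler_sum// => j _.
  by rewrite normrM ler_wpM2l.
rewrite ler_wpM2r// /m [X in 1 + X](bigD1 i)//= addrCA lerDl addr_ge0//.
by rewrite sumr_ge0// => k _; rewrite sumr_ge0.
Qed.

(* In the norm weighted by cosh (2 tau), where tau' = m dominates the
   coefficients, each Picard step halves distances, on all of [I] at once:
   no exhaustion by compact intervals is needed. *)
Theorem linear_ode : exists X : T -> R -> R, (forall i, X i c = x0 i) /\
  forall i t, I t -> is_derive t 1 (X i) (\sum_j A i j t * X j t).
Proof.
have [tau [tau0 dtau]] := antiderivative hI Ic continuous_m.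
(* [ch] is cosh (2 tau) and [sh] is sinh (2 tau) / 2, so that [sh] has derivative [m * ch] and
   [|sh| <= ch / 2]; this last bound is the source of the factor 1/2. *)
pose ch t := (expR (2 * tau t) + expR (- 2 * tau t)) / 2.
pose sh t := 4^-1 * (expR (2 * tau t) - expR (- 2 * tau t)).
have ch1 t : 1 <= ch t.
  rewrite /ch mulNr expRN; set e := expR _; have e0 : 0 < e by exact: expR_gt0.
  rewrite ler_pdivlMr// mul1r -subr_ge0.
  have -> : e + e^-1 - 2 = (e - 1) ^+ 2 / e by field; rewrite gt_eqF.
  by rewrite divr_ge0 ?sqr_ge0// ltW.
have ch0 t : 0 <= ch t by exact: le_trans ler01 (ch1 t).
have sh_ch t : `|sh t| <= ch t / 2.
  have := expR_gt0 (2 * tau t); have := expR_gt0 (- 2 * tau t).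
  by rewrite ler_norml /sh /ch => h1 h2; apply/andP; split; lra.
have shc : sh c = 0 by rewrite /sh tau0 !mulr0 subrr mulr0.
have dexp k t : I t ->
    is_derive t 1 (fun u => expR (k * tau u)) (k * m t * expR (k * tau t)).
  by move=> It; apply: is_derive_expR_fun; exact: is_deriveZ_fun (dtau t It).
have dsh t : I t -> is_derive t 1 sh (m t * ch t).
  move=> It; have dB := is_deriveB_fun (dexp 2 t It) (dexp (- 2) t It).
  by apply: (is_derive_eq (is_deriveZ_fun 4^-1 dB)); rewrite /ch; field.
have ch_cont t : I t -> {for t, continuous ch}.
  move=> It; apply: cvgM; last exact: cvg_cst.
  by apply: cvgD; apply: is_derive_continuous (dexp _ _ It).
(* The derivative of [G] is bounded by [b * (m * ch)], the derivative of [b * sh], so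
   [|G| <= b * |sh|] on both sides of [c]. *)
have contraction (X : T -> R -> R) (b : R) (G : R -> R) i : 0 <= b ->
    (forall j t, I t -> `|X j t| <= b * ch t) -> G c = 0 ->
    (forall t, I t -> is_derive t 1 G (\sum_j A i j t * X j t)) ->
    forall t, I t -> `|G t| <= b / 2 * ch t.
  move=> b0 Xb Gc dG t It.
  have dbsh u : I u -> is_derive u 1 (fun u => b * sh u) (b * (m u * ch u)).
    by move=> Iu; exact: is_deriveZ_fun (dsh u Iu).
  have le_d u : I u -> `|\sum_j A i j u * X j u| <= b * (m u * ch u).
    by move=> Iu; rewrite mulrCA; apply: norm_mulA_le => j; exact: Xb.
  suff GS : `|G t| <= b * `|sh t|.
    by rewrite (le_trans GS)// -mulrA ler_wpM2l// mulrC.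
  have [tc|/ltW ct] := leP t c.
    have := dist_le_of_is_derive hI dG dbsh le_d It Ic tc.
    rewrite Gc shc mulr0 !sub0r normrN => /le_trans; apply.
    by rewrite -mulrN ler_wpM2l// -normrN ler_norm.
  have := dist_le_of_is_derive hI dG dbsh le_d Ic It ct.
  rewrite Gc shc mulr0 !subr0 => /le_trans; apply.
  by rewrite ler_wpM2l// ler_norm.
(* Antiderivatives vanishing at [c] are chosen for all functions at once, so that the Picard step
   can be iterated; for a function not continuous on [I] the choice is arbitrary. *)
have [P hP] : exists P : (R -> R) -> R -> R,
    forall f, (forall t, I t -> {for t, continuous f}) ->
      P f c = 0 /\ forall t, I t -> is_derive t 1 (P f) (f t).
  suff /choice[P hP] : forall f : R -> R, exists F : R -> R,
      (forall t, I t -> {for t, continuous f}) ->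
      F c = 0 /\ forall t, I t -> is_derive t 1 F (f t) by exists P.
  move=> f; have [cf|ncf] := pselect (forall t, I t -> {for t, continuous f}).
    by have [F hF] := antiderivative hI Ic cf; exists F.
  by exists f.
pose step (X : T -> R -> R) i t := x0 i + P (fun u => \sum_j A i j u * X j u) t.
pose S k := iter k step (fun i => cst (x0 i)).
have step_c X : (forall j t, I t -> {for t, continuous (X j)}) ->
    forall i, step X i c = x0 i.
  move=> cX i; rewrite /step (hP _ _).1 ?addr0// => t It.
  by apply: continuous_mulA => // j; exact: cX.
have dstep X : (forall j t, I t -> {for t, continuous (X j)}) ->
    forall i t, I t -> is_derive t 1 (step X i) (\sum_j A i j t * X j t).
  move=> cX i t It; rewrite -[X in is_derive _ _ _ X]add0r.
  apply: is_deriveD_fun.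
  apply: (hP _ _).2 => // u Iu.
  by apply: continuous_mulA => // j; exact: cX.
have cS k j t : I t -> {for t, continuous (S k j)}.
  elim: k j t => [|k IH] j t It; first exact: cvg_cst.
  by apply: is_derive_continuous; exact: dstep.
have Sc k i : S k i c = x0 i by case: k => // k; exact: step_c (S k) (cS k) i.
(* [C] bounds the constant starting function, and so does [C * ch] because [ch >= 1]; this starts
   the induction that halves the successive differences. *)
pose C := \sum_i `|x0 i|.
have C0 : 0 <= C by exact: sumr_ge0.
have dS k i t : I t -> `|S k.+1 i t - S k i t| <= C / 2 ^+ k.+1 * ch t.
  elim: k i t => [|k IH] i t It.
    rewrite expr1; apply: (contraction (fun i => cst (x0 i)) C
      (fun t => S 1 i t - S 0 i t) i) => //.
    - move=> j u Iu; rewrite -[`|_|]mulr1 ler_pM// /C (bigD1 j)//= lerDl.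
      exact: sumr_ge0.
    - by rewrite !Sc subrr.
    - move=> u Iu; rewrite -[X in is_derive _ _ _ X]subr0.
      by apply: is_deriveB_fun; exact: (dstep (S 0) (cS 0)).
  have -> : C / 2 ^+ k.+2 = C / 2 ^+ k.+1 / 2 by rewrite [in LHS]exprSr invfM mulrA.
  apply: (contraction
    (fun i u => S k.+1 i u - S k i u) (C / 2 ^+ k.+1) (fun u => S k.+2 i u - S k.+1 i u) i) => //.
  - by rewrite divr_ge0// exprn_ge0.
  - by rewrite !Sc subrr.
  - move=> u Iu; under eq_bigr do rewrite mulrBr; rewrite sumrB.
    exact: is_deriveB_fun (dstep (S k.+1) (cS _) i u Iu) (dstep (S k) (cS _) i u Iu).
(* Pointwise limit of the Picard iterates; outside [I] its values are arbitrary. *)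
have [X hX] : exists X : T -> R -> R, forall i t, I t ->
    forall k, `|S k i t - X i t| <= C * ch t / 2 ^+ k.
  suff /choice[X hX] : forall i, exists Xi : R -> R, forall t, I t ->
    forall k, `|S k i t - Xi t| <= C * ch t / 2 ^+ k by exists X.
  move=> i; suff /choice[Xi hXi] : forall t, exists l, I t ->
    forall k, `|S k i t - l| <= C * ch t / 2 ^+ k by exists Xi.
  move=> t; have [It|nIt] := pselect (I t); last by exists 0.
  have [|l hl] := @exists_limit_of_geometric _ (S ^~ i ^~ t) (C * ch t); last by exists l.
  by move=> k; rewrite mulrAC; exact: dS.
(* Convergence is locally uniform: [ch] stays below [ch t + 1] near [t], so one [k] serves a whole
   neighborhood and the error splits into three parts below [e / 3]. *)
have cX i t : I t -> {for t, continuous (X i)}.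
  move=> It; apply/cvgrPdist_lt => /= e e0.
  have e30 : 0 < e / 3 by rewrite divr_gt0.
  have [k hk] := exists_half_pow_lt (C * (ch t + 1)) e30.
  have /cvgrPdist_lt/(_ _ e30) cSt := cS k i t It.
  have /cvgrPdist_lt/(_ _ (@ltr01 R)) cch := ch_cont t It.
  near=> u.
  have Iu : I u by near: u; exact: near_open_interval.
  have chu : ch u < ch t + 1.
    have : `|ch t - ch u| < 1 by near: u.
    by rewrite ltr_norml => /andP[h _]; lra.
  have near_X v : I v -> ch v <= ch t + 1 -> `|S k i v - X i v| < e / 3.
    move=> Iv chv; rewrite (le_lt_trans (hX i v Iv k))// (le_lt_trans _ hk)//.
    by rewrite ler_wpM2r ?invr_ge0 ?exprn_ge0// ler_wpM2l.
  have h1 : `|S k i t - X i t| < e / 3 by apply: near_X => //; rewrite lerDl.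
  have h2 := near_X u Iu (ltW chu).
  have h3 : `|S k i t - S k i u| < e / 3 by near: u.
  by move: h1 h2 h3; rewrite !ltr_norml => /andP[? ?] /andP[? ?] /andP[? ?];
    apply/andP; split; lra.
(* [S k.+1] is within [C * ch t / 2 ^+ k.+1] of [X] by choice of [X], and of [step X] by the
   contraction; as [k] is arbitrary, [X] is a fixed point on [I]. *)
have XE i t : I t -> X i t = step X i t.
  move=> It; apply/eqP; rewrite -subr_eq0 -normr_le0.
  apply: (@half_pow_le0 _ _ (C * ch t)) => k.
  have hZ : `|S k.+1 i t - step X i t| <= C / 2 ^+ k / 2 * ch t.
    apply: (contraction (fun i u => S k i u - X i u) _
      (fun u => S k.+1 i u - step X i u) i) => //.
    - by rewrite divr_ge0// exprn_ge0.
    - by move=> j u Iu; rewrite mulrAC; exact: hX.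
    - by rewrite Sc step_c// subrr.
    - move=> u Iu; under eq_bigr do rewrite mulrBr; rewrite sumrB.
      exact: is_deriveB_fun (dstep (S k) (cS _) i u Iu) (dstep X cX i u Iu).
  have := hX i t It k.+1.
  have -> : C * ch t / 2 ^+ k.+1 = C * ch t / 2 ^+ k / 2 by rewrite exprSr invfM mulrA.
  have {hZ} : `|S k.+1 i t - step X i t| <= C * ch t / 2 ^+ k / 2.
    by rewrite (le_trans hZ)// le_eqVlt; apply/orP; left; apply/eqP; ring.
  move: (_ / 2 ^+ k) => b; rewrite !ler_norml => /andP[? ?] /andP[? ?].
  by apply/andP; split; lra.
exists X; split=> [i|i t It]; first by rewrite XE// step_c.
apply: (@eq_in_is_derive _ _ hI _ (step X i)) => //; last exact: dstep.
by move=> u; rewrite inE => Iu; rewrite XE.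
Unshelve. all: by end_near. Qed.

End LinearODE.

(** * Smoothness, coordinatewise derivatives and vector antiderivatives *)

Section Smooth.
Variables (R : realType) (I : set R).
Hypothesis hI : open_interval I.

(** A class closed under differentiation on [I] contains, up to equality on [I], all iterated
    derivatives of its members, so these exist to every order. *)
Lemma smooth_coind (V : normedModType R) (P : (R -> V) -> Prop) :
  (forall f, P f -> exists2 g, P g & forall t, I t -> is_derive t 1 f (g t)) ->
  forall f, P f -> smooth I f.
Proof.
move=> hP f Pf k; suff [g Pg fg] : exists2 g, P g & {in I, derive1n k f =1 g}.
  move=> t It; have [dg _ /(_ t It) ddg] := hP g Pg.
  have [] // : is_derive t 1 (derive1n k f) (dg t).
  by apply: (eq_in_is_derive hI It _ ddg) => u Iu; rewrite fg.
elim: k => [|k [g Pg fg]]; first by exists f.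
have [dg Pdg ddg] := hP g Pg; exists dg => // t; rewrite inE => It.
rewrite derive1nS derive1E; apply: derive_val.
by apply: (eq_in_is_derive hI It _ (ddg t It)) => u Iu; rewrite fg.
Qed.

Lemma smooth_is_derive (V : normedModType R) (f : R -> V) t :
  smooth I f -> I t -> is_derive t 1 f (derive1 f t).
Proof. by move=> sf It; rewrite derive1E; apply/derivableP/(sf 0). Qed.

Lemma smooth_derive1 (V : normedModType R) (f : R -> V) :
  smooth I f -> smooth I (derive1 f).
Proof. by move=> sf k t It; rewrite /derive1n -iterSr; exact: (sf k.+1). Qed.

Lemma smooth_of_derive (V : normedModType R) (f g : R -> V) :
  smooth I g -> (forall t, I t -> is_derive t 1 f (g t)) -> smooth I f.
Proof.
move=> sg dfg; apply: (@smooth_coind _ (fun h => h = f \/ smooth I h)); last by left.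
move=> h [->|sh]; first by exists g => //; right.
exists (derive1 h); first by right; exact: smooth_derive1.
by move=> t; exact: smooth_is_derive.
Qed.

Lemma smooth_continuous (f : R -> R) t :
  smooth I (f : R -> R^o) -> I t -> {for t, continuous f}.
Proof. by move=> sf It; exact: is_derive_continuous (smooth_is_derive sf It). Qed.

Lemma smooth_cst (V : normedModType R) (a : V) : smooth I (cst a).
Proof.
apply: (@smooth_coind _ (fun h => exists b, h = cst b)); last by exists a.
move=> h [b ->]; exists (cst 0) => [|t _]; [by exists 0|exact: is_derive_cst].
Qed.

Section Generated.
Variables (T : finType) (A : T -> T -> R -> R) (X : T -> R -> R).

(** The algebra generated by the smooth functions and the components of a solution. The system
    expresses the derivative of each [X i] inside this algebra, which is therefore closed under
    differentiation. *)
Inductive smooth_generated : (R -> R) -> Prop :=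
| generated_smooth f : smooth I (f : R -> R^o) -> smooth_generated f
| generated_sol i : smooth_generated (X i)
| generated_add f g : smooth_generated f -> smooth_generated g ->
    smooth_generated (fun t => f t + g t)
| generated_mul f g : smooth_generated f -> smooth_generated g ->
    smooth_generated (fun t => f t * g t).

Hypothesis sA : forall i j, smooth I (A i j : R -> R^o).
Hypothesis dX : forall i t, I t -> is_derive t 1 (X i) (\sum_j A i j t * X j t).

Lemma smooth_generated_smooth f : smooth_generated f -> smooth I (f : R -> R^o).
Proof.
move: f; apply: smooth_coind => h.
elim=> [f sf|i|f g gf [df gdf hf] gg [dg gdg hg]|f g gf [df gdf hf] gg [dg gdg hg]].
- exists (derive1 (f : R -> R^o)); first exact/generated_smooth/smooth_derive1.
  by move=> t; exact: smooth_is_derive.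
- exists (fun t => \sum_j A i j t * X j t); last by move=> t; exact: dX.
  rewrite (_ : (fun t => _) = \sum_j (fun t => A i j t * X j t)); last first.
    by apply/funext => t; rewrite fct_sumE.
  elim/big_ind : _ => [|u v gu gv|j _].
  + exact/generated_smooth/smooth_cst.
  + exact: generated_add.
  + by apply: generated_mul; [exact: generated_smooth|exact: generated_sol].
- exists (fun t => df t + dg t); first exact: generated_add.
  by move=> t It; apply: is_deriveD_fun; [exact: hf|exact: hg].
- exists (fun t => df t * g t + f t * dg t).
    by apply: generated_add; exact: generated_mul.
  by move=> t It; apply: is_deriveM_fun; [exact: hf|exact: hg].
Qed.

Lemma smooth_linear_ode i : smooth I (X i : R -> R^o).
Proof. exact/smooth_generated_smooth/generated_sol. Qed.

End Generated.

Lemma smoothM (f g : R -> R) : smooth I (f : R -> R^o) -> smooth I (g : R -> R^o) ->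
  smooth I ((fun t => f t * g t) : R -> R^o).
Proof.
(* The generated class is taken with an empty index type, hence no unknowns, for its closure under
   products. *)
move=> sf sg; apply: (@smooth_generated_smooth 'I_0 (fun _ _ => f) (fun=> f)).
- by case.
- by case.
- exact: generated_mul (generated_smooth _ sf) (generated_smooth _ sg).
Qed.

Lemma smooth_sum (T : finType) (f : T -> R -> R) :
  (forall i, smooth I (f i : R -> R^o)) ->
  smooth I ((fun t => \sum_i f i t) : R -> R^o).
Proof.
move=> sf; rewrite (_ : (fun t => _) = \sum_i f i); last first.
  by apply/funext => t; rewrite fct_sumE.
elim/big_ind : _ => [|u v su sv|//]; first exact: smooth_cst.
apply: (@smooth_generated_smooth 'I_0 (fun _ _ => u) (fun=> u)).
- by case.
- by case.
- exact: generated_add (generated_smooth _ su) (generated_smooth _ sv).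
Qed.

Lemma is_derive_mx (m n : nat) (M : R -> 'M[R]_(m, n)) (dM : 'M[R]_(m, n)) (t : R) :
  is_derive t 1 M dM <-> forall i j, is_derive t 1 (fun x => M x i j) (dM i j).
Proof.
split=> [[Mt <-] i j|Mt].
  rewrite derive_mx// mxE; apply/derivableP.
  exact: (derivable_mxP M t 1).1.
have dMt : derivable M t 1 by apply/derivable_mxP => i j; case: (Mt i j).
split=> //; apply/matrixP => i j; rewrite derive_mx// mxE.
exact: derive_val.
Qed.

Lemma smooth_col (n : nat) (f : R -> 'cV[R]_n) :
  (forall j, smooth I ((fun t => f t j 0) : R -> R^o)) -> smooth I f.
Proof.
apply: (@smooth_coind _ (fun f : R -> 'cV[R]_n =>
  forall j, smooth I ((fun t => f t j 0) : R -> R^o))) => {}f sf.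
exists (fun t => \col_j derive1 (fun t => f t j 0 : R^o) t).
  move=> j; rewrite (_ : (fun t => _) = derive1 (fun t => f t j 0 : R^o)).
    exact: smooth_derive1.
  by apply/funext => t; rewrite mxE.
move=> t It; apply/is_derive_mx => i j; rewrite mxE ord1.
exact: (smooth_is_derive (sf i)).
Qed.

Lemma is_derive0_eq_mx (m n : nat) (M : R -> 'M[R]_(m, n)) (x y : R) :
  (forall t, I t -> is_derive t 1 M 0) -> I x -> I y -> M x = M y.
Proof.
move=> dM Ix Iy; apply/matrixP => i j.
apply: (is_derive0_eq hI (f := fun t => M t i j)) => // t It.
by have /is_derive_mx/(_ i j) := dM t It; rewrite mxE.
Qed.

Lemma antiderivative_col (n : nat) (c : R) (x0 : 'cV[R]_n) (f : R -> 'cV[R]_n) :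
  I c -> (forall j, smooth I ((fun t => f t j 0) : R -> R^o)) ->
  exists F, F c = x0 /\ forall t, I t -> is_derive t 1 F (f t).
Proof.
move=> Ic sf; have /choice[F hF] : forall j, exists Fj : R -> R,
    Fj c = 0 /\ forall t, I t -> is_derive t 1 Fj (f t j 0).
  by move=> j; apply: antiderivative => // t; exact: smooth_continuous.
exists (fun t => \col_j (x0 j 0 + F j t)); split.
  by apply/colP => j; rewrite mxE (hF j).1 addr0.
move=> t It; apply/is_derive_mx => i j; rewrite ord1 -[f t i 0]add0r.
under eq_fun do rewrite mxE.
exact: is_deriveD_fun (is_derive_cst (x0 i 0) t 1) ((hF i).2 t It).
Qed.

End Smooth.

(** * Matrix identities and derivatives of matrix products *)

Lemma gram_dual (R : comUnitRingType) (N : nat) (F D J : 'M[R]_N) :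
  D *m D = 1%:M -> J *m J = 1%:M -> F *m J *m F^T = D -> F^T *m D *m F = J.
Proof.
(* The hypothesis gives [F *m (J *m F^T *m D) = D *m D = 1]; a one-sided inverse of a square matrix
   is two-sided, so the factors may be exchanged. *)
move=> DD JJ FJF; have : J *m (F^T *m D *m F) = 1%:M.
  rewrite !mulmxA; apply: mulmx1C.
  by rewrite !mulmxA FJF.
by move/(congr1 (mulmx J)); rewrite mulmxA JJ mul1mx mulmx1.
Qed.

Section DeriveMatrix.
Variable R : realType.

Lemma is_derive_trmx (m n : nat) (M : R -> 'M[R]_(m, n)) dM (t : R) :
  is_derive t 1 M dM -> is_derive t 1 (fun x => (M x)^T) dM^T.
Proof.
move=> /is_derive_mx hM; apply/is_derive_mx => i j; rewrite mxE.
by under eq_fun do rewrite mxE; exact: hM.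
Qed.

Lemma is_derive_mulmx (m n p : nat) (M : R -> 'M[R]_(m, n)) (P : R -> 'M[R]_(n, p))
    dM dP (t : R) : is_derive t 1 M dM -> is_derive t 1 P dP ->
  is_derive t 1 (fun x => M x *m P x) (dM *m P t + M t *m dP).
Proof.
move=> /is_derive_mx hM /is_derive_mx hP; apply/is_derive_mx => i j.
rewrite !mxE -big_split/=; under eq_fun do rewrite mxE.
by apply: is_derive_sum_fun => k; exact: is_deriveM_fun.
Qed.

End DeriveMatrix.

(** * The Frenet equations in matrix form *)

Section FrenetMatrix.
Variables (R : realType) (n : nat).
Implicit Types (x y : 'cV[R]_n.+2) (e v : 'I_n.+2 -> 'cV[R]_n.+2).
Implicit Types (d : 'I_n.+2 -> R) (w : 'I_n.+1 -> R) (I : set R).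

Local Notation J := (@Istar R n).

Lemma ldotC x y : ldot x y = ldot y x.
Proof.
rewrite /ldot; transitivity ((x^T *m J *m y)^T 0 0); first by rewrite [RHS]mxE.
by rewrite !trmx_mul trmxK mulmxA /Istar tr_diag_mx.
Qed.

Lemma ldotZl a x y : ldot (a *: x) y = a * ldot x y.
Proof. by rewrite /ldot linearZ/= -!scalemxAl mxE. Qed.

Lemma ldot_suml (T : finType) (f : T -> 'cV[R]_n.+2) y :
  ldot (\sum_i f i) y = \sum_i ldot (f i) y.
Proof. by rewrite /ldot linear_sum/= !mulmx_suml summxE. Qed.

Lemma Istar_sqr : J *m J = 1%:M.
Proof.
rewrite /Istar mulmx_diag; apply/matrixP => i j; rewrite !mxE.
by congr (_ *+ _); case: eqP => _; rewrite ?mulrNN mulr1.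
Qed.

(** The vectors are rows, so that the Frenet system acts by left multiplication and the Gram matrix
    of the frame is [F J F^T]. *)
Definition frame_mx e : 'M[R]_n.+2 := \matrix_(l, j) e l j 0.
Definition sign_mx d : 'M[R]_n.+2 := diag_mx (\row_l d l).

Lemma sign_mx_sqr d : (forall l, d l = 1 \/ d l = -1) -> sign_mx d *m sign_mx d = 1%:M.
Proof.
move=> hd; rewrite /sign_mx mulmx_diag; apply/matrixP => i j; rewrite !mxE.
by congr (_ *+ _); case: (hd i) => ->; rewrite ?mulrNN mulr1.
Qed.

Lemma frame_mx_gram e l m :
  (frame_mx e *m J *m (frame_mx e)^T) l m = ldot (e l) (e m).
Proof.
rewrite /ldot.
have -> : (e l)^T = row l (frame_mx e) by apply/rowP => j; rewrite !mxE.
have -> : e m = col m (frame_mx e)^T by apply/colP => j; rewrite !mxE.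
by rewrite -row_mul colE mulmxA -row_mul -colE [RHS]mxE [RHS]mxE.
Qed.

Lemma pseudo_orthonormal_gram e : pseudo_orthonormal e ->
  frame_mx e *m J *m (frame_mx e)^T = sign_mx (fun l => ldot (e l) (e l)).
Proof.
move=> [_ he]; apply/matrixP => l m; rewrite frame_mx_gram !mxE.
by case: eqVneq => [->|/he].
Qed.

Lemma gram_pseudo_orthonormal e d : (forall l, d l = 1 \/ d l = -1) ->
  frame_mx e *m J *m (frame_mx e)^T = sign_mx d ->
  pseudo_orthonormal e /\ forall l, ldot (e l) (e l) = d l.
Proof.
move=> hd G; have Glm l m : ldot (e l) (e m) = d l *+ (l == m).
  by rewrite -frame_mx_gram G !mxE.
have Gll l : ldot (e l) (e l) = d l by rewrite Glm eqxx.
split=> //; split=> [l|l m lm]; first by rewrite Gll.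
by rewrite Glm (negPf lm).
Qed.

(* The Frenet equations read [e' = B D e] with [D] the diagonal matrix of the
   signs and [B] this skew-symmetric matrix. *)
Definition frenet_mx w : 'M[R]_n.+2 := \matrix_(l, m) \sum_i
  w i * ((lo i == l)%:R * (hi i == m)%:R - (hi i == l)%:R * (lo i == m)%:R).

Lemma frenet_mx_tr w : (frenet_mx w)^T = - frenet_mx w.
Proof.
apply/matrixP => l m; rewrite !mxE -sumrN; by apply: eq_bigr => i _; ring.
Qed.

Lemma frenet_mxZ a w l m : frenet_mx (fun i => a * w i) l m = a * frenet_mx w l m.
Proof. by rewrite !mxE mulr_sumr; apply: eq_bigr => i _; rewrite mulrA. Qed.

Lemma lo_inj : injective (@lo n).
Proof. by move=> i j /(congr1 val)/= /val_inj. Qed.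

Lemma hi_inj : injective (@hi n).
Proof. exact: lift_inj. Qed.

Lemma frenet_mx_lo_hi w i : frenet_mx w (lo i) (hi i) = w i.
Proof.
rewrite mxE (bigD1 i)//= !eqxx mulr1.
rewrite big1 => [|j ji].
  rewrite addr0 (_ : hi i == lo i = false) ?mul0r ?subr0 ?mulr1//.
  by apply/eqP => /(congr1 val)/=; rewrite /bump/=; lia.
rewrite (inj_eq lo_inj) (negPf ji) mul0r sub0r.
(* The two equalities together would say j + 1 = i and j = i + 1. *)
case: (eqVneq (hi j) (lo i)) => [/(congr1 val)/= h1|_]; last by rewrite mul0r oppr0 mulr0.
case: (eqVneq (lo j) (hi i)) => [/(congr1 val)/= h2|_]; last by rewrite mulr0 oppr0 mulr0.
by move: h1 h2; rewrite /bump/=; lia.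
Qed.

(** Separates the entries above the diagonal from those below it; each remaining sum has at most one
    nonzero term. *)
Lemma frenet_mx_sum w d e l : \sum_m (frenet_mx w l m * d m) *: e m =
  \sum_i (lo i == l)%:R *: ((d (hi i) * w i) *: e (hi i)) -
  \sum_i (hi i == l)%:R *: ((d (lo i) * w i) *: e (lo i)).
Proof.
under eq_bigr do rewrite mxE mulr_suml scaler_suml.
rewrite exchange_big/= -sumrB; apply: eq_bigr => i _.
transitivity (\sum_m ((w i * (lo i == l)%:R * d m * (hi i == m)%:R) *: e m
  - (w i * (hi i == l)%:R * d m * (lo i == m)%:R) *: e m)).
  apply: eq_bigr => m _; rewrite -scalerBl; congr (_ *: _).
  by move: (lo i == l)%:R (hi i == m)%:R (hi i == l)%:R (lo i == m)%:R => a1 a2 a3 a4; ring.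
rewrite sumrB; congr (_ - _).
  rewrite (bigD1 (hi i))//= eqxx big1 ?addr0 => [|m mi].
    by rewrite mulr1 scalerA; congr (_ *: _); move: (_ == l)%:R => a; ring.
  by rewrite [_ == m]eq_sym (negPf mi) mulr0 scale0r.
rewrite (bigD1 (lo i))//= eqxx big1 ?addr0 => [|m mi].
  by rewrite mulr1 scalerA; congr (_ *: _); move: (_ == l)%:R => a; ring.
by rewrite [_ == m]eq_sym (negPf mi) mulr0 scale0r.
Qed.

(** Replaces the case distinction between first, inner and last vector by one formula for all rows.
    With [w], [d] and [v] arbitrary, it applies both to the true curvatures and to the prescribed
    ratios. *)
Lemma frenet_mxP w d e v :
  [/\ v ord0 = (d (hi ord0) * w ord0) *: e (hi ord0),
      (forall i j : 'I_n.+1, j = i.+1 :> nat ->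
        v (hi i) = - (d (lo i) * w i) *: e (lo i) + (d (hi j) * w j) *: e (hi j)) &
      v ord_max = - (d (lo ord_max) * w ord_max) *: e (lo ord_max)] <->
  forall l, v l = \sum_m (frenet_mx w l m * d m) *: e m.
Proof.
have delta (f : 'I_n.+1 -> 'I_n.+2) (g : 'I_n.+1 -> 'cV[R]_n.+2) i :
    injective f -> \sum_j (f j == f i)%:R *: g j = g i.
  move=> fI; rewrite (bigD1 i)//= eqxx scale1r big1 ?addr0// => j ji.
  by rewrite (inj_eq fI) (negPf ji) scale0r.
have delta0 (f : 'I_n.+1 -> 'I_n.+2) (g : 'I_n.+1 -> 'cV[R]_n.+2) l :
    (forall j, f j != l) -> \sum_j (f j == l)%:R *: g j = 0.
  by move=> fl; rewrite big1// => j _; rewrite (negPf (fl j)) scale0r.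
have max_hi : ord_max = hi (@ord_max n) by apply/val_inj; rewrite /= /bump.
have E0 : \sum_m (frenet_mx w ord0 m * d m) *: e m =
    (d (hi ord0) * w ord0) *: e (hi ord0).
  rewrite frenet_mx_sum [X in _ - X]delta0 ?subr0// -[ord0](_ : lo ord0 = _)//.
    by rewrite (delta _ _ ord0 lo_inj).
  exact/val_inj.
have Emax : \sum_m (frenet_mx w ord_max m * d m) *: e m =
    - (d (lo ord_max) * w ord_max) *: e (lo ord_max).
  rewrite frenet_mx_sum [X in X - _]delta0 ?sub0r.
    by rewrite max_hi (delta _ _ ord_max hi_inj) scaleNr.
  by move=> j; apply/eqP => /(congr1 val)/=; have := ltn_ord j; lia.
have Ehi (i j : 'I_n.+1) : j = i.+1 :> nat ->
    \sum_m (frenet_mx w (hi i) m * d m) *: e m =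
    - (d (lo i) * w i) *: e (lo i) + (d (hi j) * w j) *: e (hi j).
  move=> ji; rewrite frenet_mx_sum (delta _ _ i hi_inj).
  have -> : hi i = lo j by apply/val_inj; rewrite /= /bump ji.
  by rewrite (delta _ _ j lo_inj) addrC scaleNr.
split=> [[v0 vi vmax] l|vE]; last first.
  by split=> [|i j ji|]; rewrite vE //; exact: Ehi.
(* An index is either first or some [hi i]; in the second case it is last or [i] has a successor. *)
have [->|] := eqVneq l ord0; first by rewrite v0 E0.
rewrite eq_sym => /unlift_some[i -> _]; rewrite -/(hi i).
have [->|] := eqVneq i ord_max; first by rewrite -max_hi vmax Emax.
move=> im; have iltn : (i.+1 < n.+1)%N.
  rewrite ltn_neqAle ltn_ord andbT; apply: contra im => /eqP[im].
  by apply/eqP/val_inj.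
by rewrite (vi i (Ordinal iltn))// (Ehi i (Ordinal iltn)).
Qed.

Lemma frenet_equationsP (s : R -> R) (e : 'I_n.+2 -> R -> 'cV[R]_n.+2) t :
  frenet_equations s e t <->
  forall l, deriv_wrt s (e l) t =
    \sum_m (frenet_mx (kappa s e ^~ t) l m * eps e m t) *: e m t.
Proof. exact: frenet_mxP. Qed.

End FrenetMatrix.

(** * Conserved quantities of the Frenet system *)

Section FrenetSystem.
Variables (R : realType) (n : nat) (I : set R).
Hypothesis hI : open_interval I.
Local Notation J := (@Istar R n).
Implicit Types (e : 'I_n.+2 -> R -> 'cV[R]_n.+2) (w : 'I_n.+1 -> R -> R).

(** The signs are fixed constants [d], not read off [e], which makes the system linear. *)
Definition frenet_solution w (d : 'I_n.+2 -> R) e := forall l t, I t ->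
  is_derive t 1 (e l) (\sum_m (frenet_mx (w ^~ t) l m * d m) *: e m t).

Lemma is_derive_frame_mx e (B : 'M[R]_n.+2) d (t : R) :
  (forall l, is_derive t 1 (e l) (\sum_m (B l m * d m) *: e m t)) ->
  is_derive t 1 (fun t => frame_mx (e ^~ t)) (B *m sign_mx d *m frame_mx (e ^~ t)).
Proof.
move=> de; apply/is_derive_mx => l j; under eq_fun do rewrite mxE.
have /is_derive_mx/(_ j 0) h := de l; apply: (is_derive_eq h).
rewrite summxE mxE; apply: eq_bigr => m _.
by rewrite /sign_mx mul_mx_diag !mxE.
Qed.

(** The derivative is F1^T D (B^T + B) D F2, which vanishes. *)
Lemma frenet_solution_pair w d e1 e2 (x y : R) :
  (forall l, d l = 1 \/ d l = -1) ->
  frenet_solution w d e1 -> frenet_solution w d e2 -> I x -> I y ->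
  (frame_mx (e1 ^~ x))^T *m sign_mx d *m frame_mx (e2 ^~ x) =
  (frame_mx (e1 ^~ y))^T *m sign_mx d *m frame_mx (e2 ^~ y).
Proof.
move=> hd de1 de2 Ix Iy; apply: (is_derive0_eq_mx hI
  (M := fun t => (frame_mx (e1 ^~ t))^T *m sign_mx d *m frame_mx (e2 ^~ t))) => // t It.
have dF1 := is_derive_frame_mx (fun l => de1 l t It).
have dF2 := is_derive_frame_mx (fun l => de2 l t It).
have d1 := is_derive_mulmx (is_derive_trmx dF1) (is_derive_cst (sign_mx d) t 1).
apply: (is_derive_eq (is_derive_mulmx d1 dF2)).
rewrite /cst /= mulmx0 addr0 !trmx_mul frenet_mx_tr {2}/sign_mx tr_diag_mx.
by rewrite !mulmxA !mulmxN !mulNmx addNr.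
Qed.

(** The conserved quantity is F^T D F, whereas the Gram matrix is F J F^T; [gram_dual] passes from
    the second to the first at [x], and back at [y]. *)
Lemma frenet_solution_gram w d e (x y : R) :
  (forall l, d l = 1 \/ d l = -1) -> frenet_solution w d e -> I x -> I y ->
  frame_mx (e ^~ x) *m J *m (frame_mx (e ^~ x))^T = sign_mx d ->
  frame_mx (e ^~ y) *m J *m (frame_mx (e ^~ y))^T = sign_mx d.
Proof.
move=> hd de Ix Iy G.
have G' := gram_dual (sign_mx_sqr hd) (@Istar_sqr R n) G.
rewrite -[X in X *m J]trmxK; apply: gram_dual; rewrite ?Istar_sqr ?sign_mx_sqr//.
by rewrite trmxK (frenet_solution_pair hd de de Iy Ix).
Qed.

(** At [y], both F1^T D F1 and F1^T D F2 equal their common value at [x], which is J; hence F1^T D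
    is invertible and can be cancelled. *)
Lemma frenet_solution_unique w d e1 e2 (x y : R) :
  (forall l, d l = 1 \/ d l = -1) ->
  frenet_solution w d e1 -> frenet_solution w d e2 -> I x -> I y ->
  frame_mx (e1 ^~ x) *m J *m (frame_mx (e1 ^~ x))^T = sign_mx d ->
  (forall l, e1 l x = e2 l x) -> forall l, e1 l y = e2 l y.
Proof.
move=> hd de1 de2 Ix Iy G e12.
have G' := gram_dual (sign_mx_sqr hd) (@Istar_sqr R n) G.
have E : frame_mx (e1 ^~ x) = frame_mx (e2 ^~ x).
  by apply/matrixP => l j; rewrite !mxE e12.
have P11 := frenet_solution_pair hd de1 de1 Iy Ix.
have P12 := frenet_solution_pair hd de1 de2 Iy Ix.
rewrite -E -P11 in P12.
have U : J *m (frame_mx (e1 ^~ y))^T *m sign_mx d *m frame_mx (e1 ^~ y) = 1%:M.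
  by rewrite -!mulmxA [X in J *m X]mulmxA P11 G' Istar_sqr.
have F12 : frame_mx (e2 ^~ y) = frame_mx (e1 ^~ y).
  have := mulmx1C U => V.
  rewrite -[LHS]mul1mx -[RHS]mul1mx -V -!mulmxA; congr (_ *m (_ *m _)).
  by rewrite mulmxA P12 mulmxA.
by move=> l; apply/colP => j; have /matrixP/(_ l j) := F12; rewrite !mxE.
Qed.

(* The sign function of a frame satisfying the equations with its own, a priori
   varying, signs is constant: (F J F^T)' = B D D + D D B^T = B + B^T = 0. *)
Lemma frenet_signs_constant w e (x y : R) :
  (forall t, I t -> pseudo_orthonormal (e ^~ t)) ->
  (forall l t, I t -> is_derive t 1 (e l)
    (\sum_m (frenet_mx (w ^~ t) l m * eps e m t) *: e m t)) ->
  I x -> I y -> forall l, eps e l x = eps e l y.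
Proof.
move=> oe de Ix Iy l; rewrite /eps -(frame_mx_gram (e ^~ x)) -(frame_mx_gram (e ^~ y)).
have -> // : frame_mx (e ^~ x) *m J *m (frame_mx (e ^~ x))^T =
             frame_mx (e ^~ y) *m J *m (frame_mx (e ^~ y))^T.
apply: (is_derive0_eq_mx hI
  (M := fun t => frame_mx (e ^~ t) *m J *m (frame_mx (e ^~ t))^T)) => // t It.
have dF := is_derive_frame_mx (fun l => de l t It).
have d1 := is_derive_mulmx dF (is_derive_cst J t 1).
apply: (is_derive_eq (is_derive_mulmx d1 (is_derive_trmx dF))).
have G := pseudo_orthonormal_gram (oe t It).
have DD := sign_mx_sqr (oe t It).1.
set F := frame_mx _ in G *; set B := frenet_mx _.
set D := sign_mx _ in G DD *; change (sign_mx (fun m => eps e m t)) with D.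
transitivity (B *m D *m (F *m J *m F^T) + F *m J *m F^T *m (B *m D)^T).
  by rewrite /cst /= mulmx0 addr0 !trmx_mul !mulmxA.
rewrite G trmx_mul frenet_mx_tr {3}/D tr_diag_mx -/D.
by rewrite -mulmxA DD mulmx1 mulmxA DD mul1mx addrN.
Qed.

End FrenetSystem.

(** * From curves to the Frenet system, and uniqueness *)

Section ShapeCurvatures.
Variables (R : realType) (n : nat) (I : set R).
Hypothesis hI : open_interval I.
Variables (z : 'I_n.+1 -> R -> R) (x0 : 'cV[R]_n.+2).
Variables (e0 : 'I_n.+2 -> 'cV[R]_n.+2) (sigma0 : R).
Hypotheses (he0 : pseudo_orthonormal e0) (hsigma0 : I sigma0).
Implicit Type c : R -> 'cV[R]_n.+2.

Local Notation d0 := (fun l => ldot (e0 l) (e0 l)).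

(* The ratios kappa_i / kappa_1, which are the curvatures with respect to the
   spherical arc length. *)
Definition curvature_ratio (i : 'I_n.+1) (t : R) : R :=
  if i == ord0 then 1 else z i t.

Lemma has_frame_and_shape_solution c :
  has_frame_and_shape I z x0 e0 sigma0 c ->
  exists (r : R -> R) (e : 'I_n.+2 -> R -> 'cV[R]_n.+2),
    [/\ c sigma0 = x0, (forall l, e l sigma0 = e0 l),
        frenet_solution I curvature_ratio d0 e,
        (forall t, I t -> r t != 0 /\ is_derive t 1 r (z ord0 t * r t)) &
        (forall t, I t -> is_derive t 1 c (r t *: e ord0 t))].
Proof.
move=> [[sc _] [s [e [[ss _] [se fe] [_ ks] [c0 e0E] shape]]]].
have s'0 t : I t -> derive1 s t != 0.
  by move=> It; apply/eqP => s0; have := ks t It; rewrite s0 mulr0 => /esym/eqP; rewrite oner_eq0.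
have k0 t : I t -> kappa s e ord0 t = (derive1 s t)^-1.
  by move=> It; apply: (mulIf (s'0 t It)); rewrite ks// mulVf// s'0.
(* Every curvature carries the same factor 1 / s', which later cancels against the one in
   [deriv_wrt]. *)
have kE i t : I t -> kappa s e i t = (derive1 s t)^-1 * curvature_ratio i t.
  move=> It; have := shape i t It; rewrite /shape_curvature /curvature_ratio.
  case: eqP => [->|_]; first by rewrite mulr1 k0.
  by move=> <-; rewrite k0// invrK mulrCA mulVf ?mulr1// s'0.
have de l t : I t -> is_derive t 1 (e l)
    (\sum_m (frenet_mx (curvature_ratio ^~ t) l m * eps e m t) *: e m t).
  move=> It; have [_ _ /frenet_equationsP/(_ l) + _ _] := fe t It.
  have -> : kappa s e ^~ t = fun i => (derive1 s t)^-1 * curvature_ratio i t.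
    by apply/funext => i; exact: kE.
  under eq_bigr do rewrite frenet_mxZ -mulrA -scalerA.
  rewrite -scaler_sumr /deriv_wrt => /scalerI <-; last by rewrite invr_eq0 s'0.
  exact: smooth_is_derive (se l) It.
have oe t : I t -> pseudo_orthonormal (e ^~ t) by move=> It; case: (fe t It).
(* The signs do not vary on [I], so they are those of the initial frame. *)
have epsE l t : I t -> eps e l t = d0 l.
  move=> It; rewrite (frenet_signs_constant hI oe de It hsigma0) /eps.
  by rewrite e0E.
exists (derive1 s), e; split=> //.
- move=> l t It; apply: (is_derive_eq (de l t It)).
  by apply: eq_bigr => m _; rewrite epsE.
(* Since kappa_1 = 1 / s', the first shape curvature - kappa_1' / kappa_1 equals s'' / s'. *)
- move=> t It; split; first exact: s'0.
  have ds : is_derive t 1 (derive1 s) (derive1 (derive1 s) t).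
    exact: (smooth_is_derive (smooth_derive1 ss) It).
  apply: (is_derive_eq ds); have /= := shape ord0 t It.
  rewrite /shape_curvature eqxx k0// invrK => <-.
  have -> : derive1 (kappa s e ord0) t = - (derive1 s t) ^- 2 * derive1 (derive1 s) t.
    rewrite derive1E (@near_eq_derive _ _ _ _ (fun u => (derive1 s u)^-1)).
      by rewrite (derive_val (is_derive := is_deriveV_fun (s'0 t It) ds)).
    near=> u; apply: k0; near: u; exact: near_open_interval.
  by field; rewrite s'0.
- move=> t It; have [_ -> _ _ _] := fe t It; rewrite /deriv_wrt scalerA.
  by rewrite divff ?s'0// scale1r; exact: smooth_is_derive sc It.
Unshelve. all: by end_near. Qed.

Lemma has_frame_and_shape_unique c1 c2 :
  has_frame_and_shape I z x0 e0 sigma0 c1 ->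
  has_frame_and_shape I z x0 e0 sigma0 c2 ->
  exists f, [/\ p_similarity f, has_center f x0 &
    forall t, I t -> c2 t = f (c1 t)].
Proof.
move=> /has_frame_and_shape_solution[r1 [e1 [c10 e10 de1 dr1 dc1]]].
move=> /has_frame_and_shape_solution[r2 [e2 [c20 e20 de2 dr2 dc2]]].
have G : frame_mx (e1 ^~ sigma0) *m @Istar R n *m (frame_mx (e1 ^~ sigma0))^T
    = sign_mx d0.
  rewrite -pseudo_orthonormal_gram//.
  by rewrite (_ : e1 ^~ sigma0 = e0)//; apply/funext => l; rewrite e10.
have e12 l t : I t -> e1 l t = e2 l t.
  move=> It; apply: (frenet_solution_unique hI he0.1 de1 de2 hsigma0 It G) => k.
  by rewrite e10 e20.
(* The two speeds solve the same scalar linear equation, so their ratio keeps its value at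
   [sigma0]. *)
pose mu := r2 sigma0 / r1 sigma0.
have rE t : I t -> r2 t = mu * r1 t.
  move=> It; have r10 := (dr1 t It).1.
  suff <- : r2 t / r1 t = mu by rewrite divfK.
  apply: (is_derive0_eq hI (f := fun u => r2 u / r1 u)) => // u Iu.
  have [r1u dr1u] := dr1 u Iu; have [_ dr2u] := dr2 u Iu.
  have dV : is_derive u 1 (fun v => (r1 v)^-1) (- (r1 u) ^- 2 * (z ord0 u * r1 u)).
    exact: is_deriveV_fun.
  by apply: (is_derive_eq (is_deriveM_fun dr2u dV)); field.
have mu0 : mu != 0.
  by rewrite mulf_neq0 ?invr_eq0 ?(dr1 _ hsigma0).1 ?(dr2 _ hsigma0).1.
(* The homothety of ratio [mu] about [x0]; it carries [c1] to [c2] because [c2 - mu *: c1] has zero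
   derivative. *)
exists (fun x => mu *: (1%:M *m x) + (x0 - mu *: x0)); split.
- exists mu, 1%:M, (x0 - mu *: x0); split=> //; last by rewrite det1.
  by rewrite /pseudo_orthogonal trmx1 mul1mx mulmx1.
- by rewrite /has_center mul1mx addrC subrK.
move=> t It; rewrite mul1mx.
have <- : c2 t - mu *: c1 t = x0 - mu *: x0; last by rewrite addrC subrK.
rewrite -{1}c20 -c10.
apply: (is_derive0_eq_mx hI (M := fun u => c2 u - mu *: c1 u)) => // u Iu.
apply: (is_derive_eq (is_deriveB (dc2 u Iu) (is_deriveZ mu (dc1 u Iu)))).
by rewrite rE// -e12// scalerA subrr.
Qed.

(** * Existence of the curve *)

Hypothesis z_smooth : forall i, smooth I (z i : R -> R^o).

Lemma smooth_curvature_ratio i : smooth I (curvature_ratio i : R -> R^o).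
Proof.
rewrite /curvature_ratio; case: eqP => _; first exact: smooth_cst.
exact: z_smooth.
Qed.

(** The system mixes the vectors but not their coordinates: for each [j], the [j]-th coordinates of
    the frame solve one scalar system, whose coefficients do not depend on [j]. *)
Lemma exists_frenet_solution : exists e : 'I_n.+2 -> R -> 'cV[R]_n.+2,
  [/\ forall l, e l sigma0 = e0 l, frenet_solution I curvature_ratio d0 e &
      forall l j, smooth I ((fun t => e l t j 0) : R -> R^o)].
Proof.
pose A l m t := frenet_mx (curvature_ratio ^~ t) l m * d0 m.
have sA l m : smooth I (A l m : R -> R^o).
  pose b i : R := (lo i == l)%:R * (hi i == m)%:R - (hi i == l)%:R * (lo i == m)%:R.
  have scst (a : R) : smooth I (cst a : R -> R^o) by exact: smooth_cst.
  have -> : A l m = fun t => (\sum_i curvature_ratio i t * cst (b i) t) * cst (d0 m) t.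
    by apply/funext => t; rewrite /A mxE.
  have sb i := smoothM hI (@smooth_curvature_ratio i) (scst (b i)).
  exact: (smoothM hI (smooth_sum hI sb) (scst (d0 m))).
have cA l m t : I t -> {for t, continuous (A l m)} by exact: smooth_continuous.
have /choice[X hX] : forall j, exists X : 'I_n.+2 -> R -> R,
    (forall l, X l sigma0 = e0 l j 0) /\
    (forall l t, I t -> is_derive t 1 (X l) (\sum_m A l m t * X m t)).
  by move=> j; exact: linear_ode.
exists (fun l t => \col_j X j l t); split.
- by move=> l; apply/colP => j; rewrite mxE (hX j).1.
- move=> l t It; apply/is_derive_mx => j k; rewrite ord1 summxE.
  under eq_fun do rewrite mxE.
  apply: (is_derive_eq ((hX j).2 l t It)).
  by apply: eq_bigr => m _; rewrite [RHS]mxE; congr (_ * _); rewrite mxE.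
- move=> l j; rewrite [X in smooth _ X](_ : _ = X j l).
    exact: (smooth_linear_ode hI sA (hX j).2).
  by apply/funext => t; rewrite mxE.
Qed.

Hypothesis z_last : forall t, I t -> z ord_max t != 0.
Hypothesis z_frenet : forall i : 'I_n.+1, (0 < i < n)%N ->
  forall t, I t -> 0 < z i t.

Lemma exists_curve : exists c, has_frame_and_shape I z x0 e0 sigma0 c.
Proof.
have [e [e0E de se]] := exists_frenet_solution.
have cz0 t : I t -> {for t, continuous (z ord0)} by exact: smooth_continuous.
(* The first shape curvature requires a speed with [r' = z ord0 * r]; the exponential provides a
   positive one. *)
have [Z [_ dZ]] := antiderivative hI hsigma0 cz0.
pose r t := expR (Z t).
have r0 t : 0 < r t by exact: expR_gt0.
have dr t : I t -> is_derive t 1 r (z ord0 t * r t).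
  by move=> It; exact: is_derive_expR_fun (dZ t It).
have sr : smooth I (r : R -> R^o).
  (* The speed is itself the solution of a linear system with one unknown. *)
  apply: (@smooth_linear_ode _ _ hI 'I_1 (fun _ _ => z ord0) (fun=> r) _ _ ord0) => //.
  by move=> _ t It; rewrite big_ord1; exact: dr.
have cr t : I t -> {for t, continuous r} by exact: smooth_continuous.
have [s [_ ds]] := antiderivative hI hsigma0 cr.
have ss : smooth I (s : R -> R^o) := smooth_of_derive hI sr ds.
have s'E t : I t -> derive1 s t = r t by move=> It; rewrite derive1E; case: (ds t It).
have s're j : smooth I ((fun t => (r t *: e ord0 t) j 0) : R -> R^o).
  under eq_fun do rewrite mxE.
  exact: (smoothM hI sr (se ord0 j)).
have [c [c0 dc]] := antiderivative_col hI x0 hsigma0 s're.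
have c'E t : I t -> derive1 c t = r t *: e ord0 t.
  by move=> It; rewrite derive1E; case: (dc t It).
have sc : smooth I c := smooth_of_derive hI (smooth_col hI s're) dc.
have oe t : I t -> pseudo_orthonormal (e ^~ t) /\ forall l, eps e l t = d0 l.
  move=> It; apply: gram_pseudo_orthonormal; first exact: he0.1.
  apply: (frenet_solution_gram hI he0.1 de hsigma0 It).
  rewrite -pseudo_orthonormal_gram//.
  by rewrite (_ : e ^~ sigma0 = e0)//; apply/funext => l; rewrite e0E.
have e'E l t : I t -> derive1 (e l) t =
    \sum_m (frenet_mx (curvature_ratio ^~ t) l m * d0 m) *: e m t.
  by move=> It; rewrite derive1E; case: (de l t It).
have dd l : d0 l * d0 l = 1 by case: (he0.1 l) => ->; rewrite ?mulrNN mulr1.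
have nd l : `|d0 l| = 1 by case: (he0.1 l) => ->; rewrite ?normrN normr1.
(* Pairing row [lo i] of the system with [e (hi i)] leaves [curvature_ratio i] times the square of a
   sign. *)
have kE i t : I t -> kappa s e i t = (r t)^-1 * curvature_ratio i t.
  move=> It; rewrite /kappa /deriv_wrt s'E// e'E// ldotZl; congr (_ * _).
  have [[_ oe'] epsE] := oe t It.
  rewrite ldot_suml (bigD1 (hi i))//= big1 ?addr0 => [|m mi].
    rewrite ldotZl frenet_mx_lo_hi -/(eps e (hi i) t) epsE -mulrA dd mulr1//.
  by rewrite ldotZl oe'// mulr0.
have k0 t : I t -> kappa s e ord0 t = (r t)^-1.
  by move=> It; rewrite kE// /curvature_ratio eqxx mulr1.
exists c; split.
  split=> // t It; rewrite c'E// ldotZl ldotC ldotZl.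
  have := (oe t It).2 ord0; rewrite /eps => ->.
  by rewrite !mulf_neq0 ?(gt_eqF (r0 t))// -normr_eq0 nd oner_eq0.
exists s, e; split.
- split=> // t It; rewrite s'E// c'E// /lnorm ldotZl ldotC ldotZl.
  have := (oe t It).2 ord0; rewrite /eps => ->.
  by rewrite mulrA normrM nd mulr1 -expr2 normrX sqrtr_sqr normr_id.
- split; first by move=> l; exact: (smooth_col hI (se l)).
  move=> t It; have [oet epsE] := oe t It; split=> //.
  + by rewrite /deriv_wrt s'E// c'E// scalerA mulVf ?gt_eqF// scale1r.
  + apply/frenet_equationsP => l.
    have -> : kappa s e ^~ t = fun i => (r t)^-1 * curvature_ratio i t.
      by apply/funext => i; exact: kE.
    rewrite /deriv_wrt s'E// e'E// scaler_sumr; apply: eq_bigr => m _.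
    by rewrite frenet_mxZ epsE -mulrA scalerA.
  + move=> i ltin; rewrite kE// mulr_gt0 ?invr_gt0// /curvature_ratio.
    case: eqVneq => // i0; apply: z_frenet => //.
    by rewrite ltin andbT lt0n.
  (* In dimension 2 the last curvature is also the first, with ratio 1; otherwise its ratio is the
     last [z]. *)
  + rewrite kE// mulf_neq0 ?invr_eq0 ?(gt_eqF (r0 t))// /curvature_ratio.
    by case: ifP => _; [exact: oner_neq0|exact: z_last].
- split; last by move=> t It; rewrite k0// s'E// mulVf ?gt_eqF.
  split.
    by apply: (@smooth_of_derive _ _ hI _ _ (cst (1 : R^o))); exact: smooth_cst.
  (* The derivative of [e ord0] is the unit vector [e (hi ord0)] up to sign, so the tangent
     indicatrix has unit speed. *)
  move=> t It; rewrite derive1E derive_id normr1 /lnorm e'E//.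
  have -> : \sum_m (frenet_mx (curvature_ratio ^~ t) ord0 m * d0 m) *: e m t =
      d0 (hi ord0) *: e (hi ord0) t.
    have [+ _ _] := (frenet_mxP (curvature_ratio ^~ t) d0 (e ^~ t) _).2 (fun=> erefl).
    by rewrite /curvature_ratio eqxx mulr1.
  rewrite ldotZl ldotC ldotZl mulrA dd mul1r.
  have := (oe t It).2 (hi ord0); rewrite /eps => ->.
  by rewrite nd sqrtr1.
- by split.
(* For the first index, kappa_1 = 1 / r gives r' / r, which is [z ord0]; for the others the factors
   1 / r cancel. *)
- move=> i t It; rewrite /shape_curvature; case: eqP => [->|/eqP i0].
    rewrite k0// invrK derive1E.
    rewrite (@near_eq_derive _ _ _ _ (fun u => (r u)^-1)).
      have dV := is_deriveV_fun (lt0r_neq0 (r0 t)) (dr t It).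
      rewrite (derive_val (is_derive := dV)).
      by rewrite /GRing.scale/=; field; rewrite gt_eqF.
    near=> u; apply: k0; near: u; exact: near_open_interval.
  rewrite kE// k0// /curvature_ratio (negPf i0) invrK mulrAC mulVf ?mul1r//.
  by rewrite gt_eqF.
Unshelve. all: by end_near. Qed.

End ShapeCurvatures.

Unset Implicit Arguments.

(** The condition [z_frenet] reflects the sign convention for Frenet frames: for [0 < i < n] the
    shape curvature is a quotient of two positive curvatures. *)
Theorem theorem7 (R : realType) (n : nat) (I : set R)
    (hI : open_interval I)
    (z : 'I_n.+1 -> R -> R)
    (z_smooth : forall i, smooth I (z i : R -> R^o))
    (z_sign : same_sign I z)
    (z_frenet : forall i : 'I_n.+1, (0 < i < n)%N ->
       forall sigma, I sigma -> 0 < z i sigma)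
    (x0 : 'cV[R]_n.+2) (e0 : 'I_n.+2 -> 'cV[R]_n.+2)
    (he0 : pseudo_orthonormal e0)
    (sigma0 : R) (hsigma0 : I sigma0) :
  (exists alpha : R -> 'cV[R]_n.+2,
     has_frame_and_shape I z x0 e0 sigma0 alpha) /\
  (forall alpha beta : R -> 'cV[R]_n.+2,
     has_frame_and_shape I z x0 e0 sigma0 alpha ->
     has_frame_and_shape I z x0 e0 sigma0 beta ->
     exists f : 'cV[R]_n.+2 -> 'cV[R]_n.+2,
       [/\ p_similarity f, has_center f x0 &
           forall sigma, I sigma -> beta sigma = f (alpha sigma)]).
Proof.
split; last by move=> alpha beta; exact: has_frame_and_shape_unique.
apply: exists_curve => // t It.
(* A strict sign on [I] makes the last function nonvanishing, as the last curvature has to be. *)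
by case: z_sign => h; have := h ord_max t It; [move/lt0r_neq0|move/ltr0_neq0].
Qed.
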